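(* Let $A$ be a continuous Scott domain with a countable regular basis $K$, and let $w:K\to[0,1]$ satisfy $w(\bot_A)=0$, $w(k)>0$ for $k\in K\setminus\{\bot_A\}$, and $\sum_{k\in K}w(k)=1$. For $K_0\subseteq K$ put $W(K_0)=\sum_{k\in K_0}w(k)$; for $x\in A$ put $K_x=\{k\in K\mid k\ll x\}$ and $I_x=\{k\in K\mid k\sqcup x\text{ does not exist}\}$; and let $$u(x,y)=1-W(K_x\cap K_y)-W(I_x\cap I_y),\qquad l(x,y)=W(K_x\cap I_y)+W(K_y\cap I_x).$$ Then for all $x,y\in\mathrm{Total}(A)$, $l(x,y)=u(x,y)$. Moreover, defining $\mu:\mathrm{Total}(A)\times\mathrm{Total}(A)\to\mathbb R$ by $\mu(x,y)=l(x,y)=u(x,y)$, the pair $(\mathrm{Total}(A),\mu)$ is a metric space, and its metric topology is the subspace topology induced by the Scott topology on $A$.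
   Context: Directed sets are nonempty. A dcpo is a poset with least element $\bot$ in which every directed subset has a least upper bound. $x\ll y$ means: for every directed $S$ with $y\sqsubseteq\sqcup S$ there is $s\in S$ with $x\sqsubseteq s$. A continuous dcpo with basis $K\subseteq A$: for every $a\in A$ the set $\{k\in K\mid k\ll a\}$ is directed with supremum $a$. A continuous Scott domain is a continuous dcpo in which every subset with an upper bound has a least upper bound. $U$ is Scott open if it is upward closed and meets every directed $S$ with $\sqcup S\in U$. $\mathrm{Total}(A)$ is the set of maximal elements of $A$. The basis $K$ is regular if for all $k\in K$ and $x\in\mathrm{Total}(A)$, $k\sqsubseteq x$ implies $k\ll x$. *)

(* Defs.v *)
From HB Require Import structures.
From mathcomp Require Import all_boot all_order all_algebra.
From mathcomp Require Import all_classical all_reals all_analysis.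

Set Implicit Arguments.
Unset Strict Implicit.
Unset Printing Implicit Defensive.

Import Order.TTheory GRing.Theory Num.Theory.

Local Open Scope classical_set_scope.
Local Open Scope ring_scope.

Section domain_theory.
Context {disp : Order.disp_t} {A : porderType disp}.
Implicit Types (x y a s : A) (S U K : set A).

Definition directed S :=
  S !=set0 /\
  forall x y, S x -> S y -> exists2 z, S z & (x <= z)%O /\ (y <= z)%O.

Definition way_below x y :=
  forall S s, directed S -> isLub S s -> (y <= s)%O ->
    exists2 z, S z & (x <= z)%O.

Definition basis_of_domain K :=
  forall a, directed [set k | K k /\ way_below k a] /\
            isLub [set k | K k /\ way_below k a] a.

Definition scott_open U :=
  (forall x y, U x -> (x <= y)%O -> U y) /\
  (forall S s, directed S -> isLub S s -> U s -> S `&` U !=set0).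

Definition Total : set A := [set x | forall y, (x <= y)%O -> y = x].

Definition regular K :=
  forall k x, K k -> Total x -> (k <= x)%O -> way_below k x.

Definition sup_exists x y := exists z, isLub [set x; y] z.

Lemma scott_openT : scott_open setT.
Proof. by split => // S s [[x Sx] _] _ _; exists x. Qed.

Lemma scott_openI : setI_closed scott_open.
Proof.
move=> U V [Uup Udir] [Vup Vdir]; split.
  by move=> x y [Ux Vx] xy; split; [exact: Uup xy|exact: Vup xy].
move=> S s dS Ss [Us Vs].
have [x [Sx Ux]] := Udir _ _ dS Ss Us; have [y [Sy Vy]] := Vdir _ _ dS Ss Vs.
have [z Sz [xz yz]] := dS.2 _ _ Sx Sy.
by exists z; split => //; split; [exact: Uup xz|exact: Vup yz].
Qed.

Lemma scott_open_bigcup (I : Type) (F : I -> set A) :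
  (forall i, scott_open (F i)) -> scott_open (\bigcup_i F i).
Proof.
move=> oF; split.
  by move=> x y [i _ Fx] xy; exists i => //; exact: (oF i).1 _ _ Fx xy.
move=> S s dS Ss [i _ Fs]; have [x [Sx Fx]] := (oF i).2 _ _ dS Ss Fs.
by exists x; split => //; exists i.
Qed.

End domain_theory.

Arguments Total {disp} A.

(* The least element is part of [bPOrderType]. *)
Definition dcpo (disp : Order.disp_t) (A : bPOrderType disp) :=
  forall S : set A, directed S -> exists s, isLub S s.

Definition continuous_dcpo (disp : Order.disp_t) (A : bPOrderType disp) :=
  dcpo A /\ exists K : set A, basis_of_domain K.

Definition continuous_Scott_domain (disp : Order.disp_t)
    (A : bPOrderType disp) :=
  continuous_dcpo A /\
  forall S : set A, has_ubound S -> exists s, isLub S s.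

(* [A] equipped with its Scott topology *)
Definition scott (disp : Order.disp_t) (A : porderType disp) : Type := A.

HB.instance Definition _ (disp : Order.disp_t) (A : porderType disp) :=
  Choice.on (scott A).
HB.instance Definition _ (disp : Order.disp_t) (A : porderType disp) :=
  isOpenTopological.Build (scott A)
    (@scott_openT disp A) (@scott_openI disp A) (@scott_open_bigcup disp A).

Section distances.
Context {R : realType} {disp : Order.disp_t} {A : bPOrderType disp}.
Variables (K : set A) (w : A -> R).
Implicit Types (x y : A) (J : set A).

(* [\esum] is [\bar R]-valued; its values are finite when the total weight of
   [K] is 1 and [J `<=` K].  Values of [w] outside [K] are never used. *)
Definition W J : R := fine (\esum_(k in J) (w k)%:E).

Definition below x := [set k | K k /\ way_below k x].

Definition incompatible x := [set k | K k /\ ~ sup_exists k x].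

Definition u x y : R :=
  1 - W (below x `&` below y) - W (incompatible x `&` incompatible y).

Definition l x y : R :=
  W (below x `&` incompatible y) + W (below y `&` incompatible x).

Definition mu (x y : Total A) : R := l (\val x) (\val y).

End distances.

Record is_metric (R : realType) (T : Type) (d : T -> T -> R) : Prop := IsMetric {
  metric_ge0 : forall x y, 0 <= d x y ;
  metric_eq0 : forall x y, d x y = 0 <-> x = y ;
  metric_symmetric : forall x y, d x y = d y x ;
  metric_triangular : forall x y z, d x z <= d x y + d y z
}.

(* [T] equipped with the distance [d] and the topology of its open balls *)
Definition metric_space (R : realType) (T : Type) (d : T -> T -> R)
  (dP : is_metric d) : Type := T.

Section metric_space_instance.
Context (R : realType) (T : choiceType) (d : T -> T -> R) (dP : is_metric d).

Let dxx (x : metric_space dP) : d x x = 0.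
Proof. exact: (metric_eq0 dP x x).2 erefl. Qed.

Let d_eq (x y : metric_space dP) : d x y = 0 -> x = y.
Proof. exact: (metric_eq0 dP x y).1. Qed.

Let d_triangle (y x z : metric_space dP) : d x z <= d x y + d y z.
Proof. exact: metric_triangular. Qed.

HB.instance Definition _ := Choice.on (metric_space dP).
HB.instance Definition _ := @isMetric.Build R (metric_space dP)
  d dxx d_eq (metric_symmetric dP) d_triangle.

End metric_space_instance.

(* Main.v *)
(* For a maximal element [x], regularity makes a basis element either way
   below [x] or incompatible with [x], so [incompatible x] is the complement of
   [below x] in [K] and both [l x y] and [u x y] are the weight of the symmetric
   difference of [below x] and [below y]; the metric axioms follow, as [x] is
   the supremum of [below x].  If [k << x] lies in a Scott open set [U], the
   ball of radius [w k] around [x] lies in [U].  Conversely, all but [e] of the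
   weight is carried by a finite set [F], and each of the conditions "[k << y]"
   and "[k] is incompatible with [y]" for [k] in [F] is Scott open in [y]. *)

Require Import Defs.
From HB Require Import structures.
From mathcomp Require Import all_boot all_order all_algebra.
From mathcomp Require Import all_classical all_reals all_analysis.
From mathcomp Require Import lra.
Set Implicit Arguments.
Unset Strict Implicit.
Unset Printing Implicit Defensive.
Import Order.TTheory GRing.Theory Num.Theory.
Local Open Scope classical_set_scope.
Local Open Scope ring_scope.

(** * Way-below relation and compatibility in a poset *)

Section way_below_theory.
Context {disp : Order.disp_t} {A : porderType disp}.
Implicit Types (x y z k : A) (K : set A).

Lemma way_below_le x y : way_below x y -> (x <= y)%O.
Proof.
move=> /(_ [set y] y) []//.
- by split; [exists y|move=> _ _ -> ->; exists y].
- by split=> [_ ->|b] //; apply.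
- by move=> _ ->.
Qed.

Lemma le_way_below_trans x y z : (x <= y)%O -> way_below y z -> way_below x z.
Proof.
move=> xy yz S s dS Ss zs; have [t St yt] := yz _ _ dS Ss zs.
by exists t => //; exact: le_trans yt.
Qed.

Lemma way_below_le_trans x y z : way_below x y -> (y <= z)%O -> way_below x z.
Proof. by move=> xy yz S s dS Ss zs; apply: xy dS Ss (le_trans yz zs). Qed.

Lemma sup_exists_le x y : (x <= y)%O -> sup_exists x y.
Proof. by exists y; split=> [_ [->|->]|b]//; apply; right. Qed.

(** The supremum lies above the maximal [y], hence equals it. *)
Lemma sup_exists_Total x y : Total A y -> sup_exists x y -> (x <= y)%O.
Proof.
move=> Ty [z [ub _]]; rewrite -(Ty z); first by apply: ub; left.
by apply: ub; right.
Qed.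

(* Interpolation: the basis elements way below some member of [S] form a
   directed set with the same supremum as [S]. *)
Lemma scott_open_way_below K x :
  basis_of_domain K -> scott_open [set y | way_below x y].
Proof.
move=> Kb; split=> [y z|S s dS Ss xs]; first exact: way_below_le_trans.
pose D := [set k | K k /\ exists2 t, S t & way_below k t].
have dD : directed D.
  split.
    have [t St] := dS.1; have [[[k [Kk kt]] _] _] := Kb t.
    by exists k; split=> //; exists t.
  move=> k1 k2 [Kk1 [t1 St1 k1t1]] [Kk2 [t2 St2 k2t2]].
  have [t St [t1t t2t]] := dS.2 _ _ St1 St2.
  have [[_ dt] _] := Kb t.
  have [||k [Kk kt] k12] := dt k1 k2.
  - by split=> //; exact: way_below_le_trans t1t.
  - by split=> //; exact: way_below_le_trans t2t.
  by exists k => //; split=> //; exists t.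
have Ds : isLub D s.
  split=> [k [_ [t St kt]]|b Db].
    by apply: (le_trans (way_below_le kt)); exact: Ss.1.
  apply: Ss.2 => t St; have [_ [_]] := Kb t; apply=> k [Kk kt].
  by apply: Db; split=> //; exists t.
have [k [Kk [t St kt]] xk] := xs _ _ dD Ds (lexx _).
by exists t; split=> //; exact: le_way_below_trans kt.
Qed.

End way_below_theory.

(** * Incompatibility with a basis element as an open condition *)

Section incompatibility.
Context {disp : Order.disp_t} {A : bPOrderType disp}.
Variable K : set A.
Implicit Types (x y k : A).

Lemma below_inj x y : basis_of_domain K -> below K x = below K y -> x = y.
Proof.
move=> Kb xy; have [_ [xub xlub]] := Kb x; have [_ [yub ylub]] := Kb y.
move: xy; rewrite /below => xy.
apply/le_anti/andP.
by split; [apply: xlub; rewrite xy|apply: ylub; rewrite -xy].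
Qed.

(** Maximality turns compatibility with [x] into order, and regularity turns order into
    way-below. *)
Lemma incompatible_Total x : regular K -> Total A x ->
  incompatible K x = K `\` below K x.
Proof.
move=> Kr Tx; apply/seteqP; split=> k [Kk kx]; split=> //.
  by move=> [_ /way_below_le/sup_exists_le].
by move=> /(sup_exists_Total Tx) /(Kr _ _ Kk Tx) kx'; exact: kx.
Qed.

(* If [k] were compatible with every [k' << x], the suprema [k \/ k'] would
   form a directed set whose supremum bounds [k] and [x]. *)
Lemma incompatible_way_below k x :
  continuous_Scott_domain A -> basis_of_domain K -> ~ sup_exists k x ->
  exists2 k', below K x k' & ~ sup_exists k k'.
Proof.
move=> [[Adcpo _] Abc] Kb kx; apply: contrapT => nk'; apply: kx.
have compat k' : below K x k' -> sup_exists k k'.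
  by move=> xk'; apply: contrapT => kk'; apply: nk'; exists k'.
have [[[k0 xk0] dx] [_ xlub]] := Kb x.
pose D := [set z | exists2 k', below K x k' & isLub [set k; k'] z].
have lub_le k' z : isLub [set k; k'] z -> (k <= z)%O /\ (k' <= z)%O.
  by move=> [ub _]; split; apply: ub; [left|right].
have dD : directed D.
  split; first by have [z kz] := compat _ xk0; exists z; exists k0.
  move=> z1 z2 [k1 xk1 [_ z1lub]] [k2 xk2 [_ z2lub]].
  have [k3 xk3 [k13 k23]] := dx _ _ xk1 xk2.
  have [z3 z3lub] := compat _ xk3; have [kz3 k3z3] := lub_le _ _ z3lub.
  exists z3; first by exists k3.
  split; [apply: z1lub => _ [->|->]//|apply: z2lub => _ [->|->]//].
    exact: le_trans k3z3.
  exact: le_trans k3z3.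
have [s [sub _]] := Adcpo _ dD.
apply: Abc; exists s => _ [->|->].
  have [z kz] := compat _ xk0; apply: le_trans (lub_le _ _ kz).1 _.
  by apply: sub; exists k0.
apply: xlub => k' xk'; have [z kz] := compat _ xk'.
by apply: le_trans (lub_le _ _ kz).2 _; apply: sub; exists k'.
Qed.

(** Some [k'] way below the supremum is already incompatible with [k]; a member of [S] above [k']
    inherits this, since by bounded completeness compatibility only requires a common upper
    bound. *)
Lemma scott_open_incompatible k :
  continuous_Scott_domain A -> basis_of_domain K ->
  scott_open [set x | ~ sup_exists k x].
Proof.
move=> Ad Kb; split=> [x y kx xy [z [ub _]]|S s dS Ss ks].
  apply: kx; apply: Ad.2; exists z => _ [->|->]; first by apply: ub; left.
  by apply: le_trans xy _; apply: ub; right.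
have [k' [_ k's] kk'] := incompatible_way_below Ad Kb ks.
have [t St k't] := k's _ _ dS Ss (lexx _).
exists t; split=> // -[z [ub _]]; apply: kk'; apply: Ad.2.
exists z => _ [->|->]; first by apply: ub; left.
by apply: le_trans k't _; apply: ub; right.
Qed.

Lemma near_scott (U : set A)
    (x : initial_topology (\val : Total A -> scott A)) :
  scott_open U -> U (\val x) -> \forall y \near x, U (\val y).
Proof. by move=> oU Ux; apply: open_nbhs_nbhs; split=> //; exists U. Qed.

(** On maximal points [k] being way below [y] and its negation, which is incompatibility, are both
    open conditions, so each is locally constant. *)
Lemma near_below k (x : initial_topology (\val : Total A -> scott A)) :
  continuous_Scott_domain A -> basis_of_domain K -> regular K -> K k ->
  \forall y \near x, below K (\val y) k <-> below K (\val x) k.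
Proof.
move=> Ad Kb Kr Kk.
have incE (y : Total A) : (~ sup_exists k (\val y)) <-> ~ below K (\val y) k.
  have := incompatible_Total Kr (set_valP y); move=> /seteqP[le ge]; split=> h.
    by have [] := le k (conj Kk h).
  by have [] := ge k (conj Kk h).
have [kx|kx] := pselect (below K (\val x) k).
  apply: filterS (near_scott (scott_open_way_below k Kb) kx.2) => y /= ky.
  by split.
have /incE/(near_scott (scott_open_incompatible k Ad Kb)) := kx.
apply: filterS => y /= /incE ky.
by split.
Qed.
End incompatibility.

(** * [W] as a finite measure on subsets of [K] *)

Section weight.
Context {R : realType} {disp : Order.disp_t} {A : bPOrderType disp}.
Variables (K : set A) (w : A -> R).
Hypothesis w_ge0 : forall k, K k -> 0 <= w k.
Hypothesis w_sum : (\esum_(k in K) (w k)%:E = 1)%E.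
Implicit Types J : set A.

Let esum_w_ge0 J : J `<=` K -> (0 <= \esum_(k in J) (w k)%:E)%E.
Proof. by move=> JK; apply: esum_ge0 => k /JK/w_ge0; rewrite lee_fin. Qed.

Let esum_wID J B : J `<=` K -> (\esum_(k in J) (w k)%:E =
  \esum_(k in J `&` B) (w k)%:E + \esum_(k in J `&` ~` B) (w k)%:E)%E.
Proof. by move=> JK; apply: esumID => k /JK/w_ge0; rewrite lee_fin. Qed.

(** The sum over [J] is at most the total 1, so [fine] loses nothing. *)
Lemma WE J : J `<=` K -> (W w J)%:E = (\esum_(k in J) (w k)%:E)%E.
Proof.
move=> JK; rewrite fineK// ge0_fin_numE ?esum_w_ge0//.
apply: (@le_lt_trans _ _ 1%E); last exact: ltry.
rewrite -w_sum (@esum_wID K J)// setIidr// leeDl// esum_w_ge0//.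
Qed.

Lemma W_total : W w K = 1.
Proof. by rewrite /W w_sum. Qed.

Lemma WID J B : J `<=` K -> W w J = W w (J `&` B) + W w (J `\` B).
Proof.
move=> JK; apply: EFin_inj; rewrite EFinD !WE//; last 2 first.
- by move=> k [/JK].
- by move=> k [/JK].
by rewrite (@esum_wID _ B)// setDE.
Qed.

Lemma W_ge0 J : J `<=` K -> 0 <= W w J.
Proof. by move=> JK; rewrite -lee_fin WE// esum_w_ge0. Qed.

Lemma le_W J J' : J' `<=` K -> J `<=` J' -> W w J <= W w J'.
Proof.
move=> J'K JJ'; rewrite (@WID J' J)// (setIidr JJ') lerDl W_ge0//.
by move=> k [/J'K].
Qed.

Lemma W_setU J J' : J `<=` K -> J' `<=` K -> J `&` J' = set0 ->
  W w (J `|` J') = W w J + W w J'.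
Proof.
move=> JK J'K JJ'; rewrite (@WID _ J); last by move=> k [/JK|/J'K].
congr (W w _ + W w _); apply/seteqP; split=> k /=; first by case.
- by move=> Jk; split=> //; left.
- by case=> -[].
- move=> J'k; split; first by right.
  by move=> Jk; suff : set0 k by []; rewrite -JJ'.
Qed.

Lemma le_W_set1 J k : J `<=` K -> J k -> w k <= W w J.
Proof.
move=> JK Jk; have -> : w k = W w [set k].
  by rewrite /W esum_set1// lee_fin; exact/w_ge0/JK.
by apply: le_W => // _ ->.
Qed.

(** The total weight is a supremum of finite sums; one exceeding [1 - e] leaves less than [e]
    outside. *)
Lemma W_finite_approx (e : R) : 0 < e ->
  exists F : set A, [/\ finite_set F, F `<=` K & W w (K `\` F) < e].
Proof.
move=> e0; have : ((1 - e)%:E < \esum_(k in K) (w k)%:E)%E.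
  by rewrite w_sum lte_fin gtrBl.
move=> /ereal_sup_gt[_ [F [finF FK] <-]].
rewrite -esum_fset//; last by move=> k /[1!inE] /FK/w_ge0; rewrite lee_fin.
rewrite -WE// lte_fin => FW; exists F; split=> //.
have := @WID K F; rewrite W_total (setIidr FK) => /(_ (@subset_refl _ K)).
lra.
Qed.
End weight.

(** * The distance on maximal points and its balls *)

Section distance.
Context {R : realType} {disp : Order.disp_t} {A : bPOrderType disp}.
Variables (K : set A) (w : A -> R).
Hypothesis K_basis : basis_of_domain K.
Hypothesis K_regular : regular K.
Hypothesis w_ge0 : forall k, K k -> 0 <= w k.
Hypothesis w_gt0 : forall k, K k -> k <> \bot%O -> 0 < w k.
Hypothesis w_sum : (\esum_(k in K) (w k)%:E = 1)%E.
Implicit Types x y z : A.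

(** Kept one-sided: the triangle inequality holds for each half of the symmetric difference, even at
    points that are not maximal. *)
Definition below_diff x y := below K x `\` below K y.

Let below_diffK x y : below_diff x y `<=` K.
Proof. by move=> k [[]]. Qed.

Let belowI_incompatible x y : Total A y ->
  below K x `&` incompatible K y = below_diff x y.
Proof.
move=> Ty; rewrite incompatible_Total// setIDA.
by rewrite (setIidl (_ : below K x `<=` K))// => k [].
Qed.

Lemma l_Total x y : Total A x -> Total A y ->
  l K w x y = W w (below_diff x y) + W w (below_diff y x).
Proof. by move=> Tx Ty; rewrite /l !belowI_incompatible. Qed.

(** [below K x] and [below K y] cut [K] into four pieces of total weight 1; [u] removes the pieces
    in both and in neither, leaving the two differences. *)
Lemma l_eq_u x y : Total A x -> Total A y -> l K w x y = u K w x y.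
Proof.
move=> Tx Ty; rewrite l_Total// /u !incompatible_Total//.
have xK : below K x `<=` K by move=> k [].
rewrite -(W_total w_sum).
rewrite (@WID _ _ _ K w w_ge0 w_sum K (below K x))// (setIidr xK).
rewrite (WID w_ge0 w_sum (below K y) xK).
rewrite (@WID _ _ _ K w w_ge0 w_sum (K `\` below K x) (below K y));
  last by move=> k [].
have -> : (K `\` below K x) `&` below K y = below_diff y x.
  by apply/seteqP; split=> k /=; [case=> -[]|case=> -[]].
have -> : (K `\` below K x) `\` below K y =
    (K `\` below K x) `&` (K `\` below K y).
  by apply/seteqP; split=> k /=; [case=> -[]|case=> -[? ?] []].
rewrite -/(below_diff x y); lra.
Qed.

(** One separating basis element bounds the distance from below, which serves both separation of
    points and the choice of radii. *)
Lemma w_le_mu (x y : Total A) k :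
  below_diff (\val x) (\val y) k -> w k <= mu K w x y.
Proof.
move=> xyk; rewrite /mu l_Total; [|exact: set_valP..].
rewrite (le_trans (le_W_set1 w_ge0 w_sum (@below_diffK _ _) xyk))// lerDl.
exact: W_ge0 w_sum _ _.
Qed.

Lemma mu_le_W (x y : Total A) J : J `<=` K ->
  below_diff (\val x) (\val y) `|` below_diff (\val y) (\val x) `<=` J ->
  mu K w x y <= W w J.
Proof.
move=> JK xyJ; rewrite /mu l_Total; [|exact: set_valP..].
rewrite -(W_setU w_ge0 w_sum); [|exact: below_diffK..|].
  exact: le_W w_sum _ _ JK xyJ.
by rewrite -subset0 => k [[xk _] [_ /(_ xk)]].
Qed.

(* The least element may carry weight 0, but it never separates two points. *)
Lemma below_diff_neq_bot x y k : below_diff x y k -> k <> \bot%O.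
Proof.
move=> [[Kk _] nyk] k0; apply: nyk; split=> //.
have [[[j [Kj jy]] _] _] := K_basis y.
by apply: le_way_below_trans jy; rewrite k0 le0x.
Qed.

Lemma mu_ge0 (x y : Total A) : 0 <= mu K w x y.
Proof.
by rewrite /mu l_Total ?addr_ge0//; (exact: set_valP || exact: W_ge0 w_sum _ _).
Qed.

Lemma mu_sym (x y : Total A) : mu K w x y = mu K w y x.
Proof. by rewrite /mu /l addrC. Qed.

Lemma mu0_below (x y : Total A) : mu K w x y = 0 ->
  below K (\val x) `<=` below K (\val y).
Proof.
move=> xy0 k xk; apply: contrapT => yk.
have xyk : below_diff (\val x) (\val y) k by [].
have := w_le_mu xyk; rewrite xy0 leNgt w_gt0//; first exact: below_diffK xyk.
exact: below_diff_neq_bot xyk.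
Qed.

Lemma W_below_diff_triangle x y z :
  W w (below_diff x z) <= W w (below_diff x y) + W w (below_diff y z).
Proof.
(* An element separating [x] from [z] separates [y] from [z] if it is way below [y], and [x] from
   [y] otherwise. *)
rewrite (WID w_ge0 w_sum (below K y) (@below_diffK x z)) addrC.
by apply: lerD; apply: (le_W w_ge0 w_sum) => // k [[]].
Qed.

Lemma mu_is_metric : is_metric (mu K w).
Proof.
split; [exact: mu_ge0| |exact: mu_sym|].
- move=> x y; split=> [xy0|->].
    apply/val_inj/(below_inj K_basis)/seteqP.
    by split; apply: mu0_below; rewrite // mu_sym.
  rewrite /mu l_Total; [|exact: set_valP..].
  by rewrite /below_diff setDv /W esum_set0 addr0.
- move=> x y z; rewrite /mu !l_Total; try exact: set_valP.
  have := W_below_diff_triangle (\val x) (\val y) (\val z).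
  have := W_below_diff_triangle (\val z) (\val y) (\val x); lra.
Qed.

Lemma near_mu_ball
    (x : initial_topology (\val : Total A -> scott A)) (e : R) :
  continuous_Scott_domain A -> 0 < e ->
  \forall y \near x, mu K w x y < e.
Proof.
move=> Ad e0; have [F [finF FK Fe]] := W_finite_approx w_ge0 w_sum e0.
have : \forall y \near x, forall k, F k ->
    (below K (\val y) k <-> below K (\val x) k).
  pose B k := [set y : Total A | below K (\val y) k <-> below K (\val x) k].
  have : nbhs x (\bigcap_(k in F) B k).
    (* Finiteness of [F] makes this intersection of neighbourhoods a neighbourhood. *)
    have /finite_fsetP[X FX] := finF; rewrite FX; apply: filter_bigI => k kX.
    by apply: near_below => //; apply: FK; rewrite FX.
  by apply: filterS => y By k kF; exact: By.
(* The two [below] sets agree on [F], so they differ only within the light remainder of [K]. *)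
apply: filterS => y xyF; apply: le_lt_trans Fe; apply: mu_le_W => [k []//|].
move=> k [] [[Kk ak] bk]; split=> // /xyF[yx xy].
  by apply: bk; exact: xy.
by apply: bk; exact: yx.
Qed.

Lemma mu_ball_scott_open (U : set A) (x : Total A) : scott_open U ->
  U (\val x) -> exists2 e : R, 0 < e &
    forall y : Total A, mu K w x y < e -> U (\val y).
Proof.
move=> oU Ux; have [dx lx] := K_basis (\val x).
have [k [[Kk kx] Uk]] := oU.2 _ _ dx lx Ux.
(* If [k] is bottom, its weight may vanish and give no radius, but then [U] is all of [A] and any
   radius works. *)
have [k0|k0] := eqVneq k \bot%O.
  by exists 1 => // y _; apply: oU.1 Uk _; rewrite k0 le0x.
exists (w k) => [|y xy]; first by apply: w_gt0 => //; exact/eqP.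
(* A [y] not above [k] would be separated from [x] by [k], hence at distance at least [w k]. *)
apply: oU.1 Uk _; apply: contrapT => ky.
have : below_diff (\val x) (\val y) k by split=> // -[_ /way_below_le].
by move=> /w_le_mu; rewrite leNgt xy.
Qed.

End distance.

Theorem theorem10p6p2 (R : realType) (disp : Order.disp_t)
    (A : bPOrderType disp) (K : set A) (w : A -> R)
    (A_domain : continuous_Scott_domain A)
    (K_basis : basis_of_domain K) (K_countable : countable K)
    (K_regular : regular K)
    (w_unit : forall k, K k -> 0 <= w k <= 1)
    (w_bot : w \bot%O = 0)
    (w_gt0 : forall k, K k -> k <> \bot%O -> 0 < w k)
    (w_sum : (\esum_(k in K) (w k)%:E = 1)%E) :
  (forall x y : A, Total A x -> Total A y -> l K w x y = u K w x y) /\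
  (exists mu_metric : is_metric (mu K w),
    forall U : set (Total A),
      open (U : set (metric_space mu_metric)) <->
      open (U : set (initial_topology (\val : Total A -> scott A)))).
Proof.
have w_ge0 k : K k -> 0 <= w k by move=> /w_unit/andP[].
split; first by move=> x y; exact: l_eq_u.
exists (mu_is_metric K_basis K_regular w_ge0 w_gt0 w_sum).
set mP := mu_is_metric _ _ _ _ _ => U; split.
  rewrite !openE => oU x /oU.
  move=> /(nbhs_ballP (x : metric_space mP))[e e0 xeU].
  have := near_mu_ball K_basis K_regular w_ge0 w_sum x A_domain e0.
  apply: filterS => y xy.
  by apply: xeU; rewrite ballEmdist.
move=> [V oV <-]; rewrite openE => x Vx.
have [e e0 xeV] := mu_ball_scott_open K_basis K_regular w_ge0 w_gt0 w_sum oV Vx.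
by apply/(nbhs_ballP (x : metric_space mP)); exists e.
Qed.
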